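(* Consider the linear dynamical network $\dot x = Ax+Bu$, $y=Cx$ with $A\in\mathbb{R}^{N\times N}$, $B\in\mathbb{R}^{N\times M}$, $C\in\mathbb{R}^{P\times N}$, where each row of $C$ is a canonical unit (row) vector, and with nodes $\mathcal{V}=\{v_1,\dots,v_N\}$. Then Algorithm 1 (described in the context) identifies the set $\mathcal{O}$ of observable nodes of the network, i.e. the set of nodes it outputs is exactly $\mathcal{O}$.
   Context: The scalar $x_i$ (the $i$-th component of $x\in\mathbb{R}^N$) is the state of node $v_i$; $y$ is the stack vector of the states of the sensor nodes (each row of $C$ has a single nonzero entry, equal to $1$, whose position $j$ indicates that $v_j$ is a sensor node). A node $v_j$ is observable iff it is possible to reconstruct the value of its state $x_j$ from knowledge of the control signals $u$ and of the measured states $y$, i.e. iff $x_j(\cdot)$ on a time interval $[0,T]$, $T>0$, is uniquely determined by $u(\cdot)$ and $y(\cdot)$ on that interval (the matrices $A,B,C$ being known). The set of observable nodes $\mathcal{O}$ is the maximal set of nodes that are simultaneously observable. Let $O$ be the observability matrix obtained by stacking $C,CA,\dots,CA^{N-1}$, and let $q=\mathrm{rank}(O)$. Let $Q$ be the $q\times N$ matrix obtained by stacking the first $q$ linearly independent rows of $O$, with columns permuted so that $Q=[H\ F]$ with $H$ a $q\times q$ full rank matrix. Each column of $Q$ (and of every matrix obtained from it by row operations and column permutations, tracking the permutations) is associated with a network node: the column originating from column $j$ of $O$ is associated with $v_j$. Algorithm 1. Initialize $k=1$, $Q^1=Q$, $H^1=H$, $F^1=F$, $q_1=q$. While $F^k\neq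 \mathbf{0}$: 1. Compute $f_k=\mathrm{rank}(F^k)$. 2. By linear combinations of the rows of $Q^k=[H^k\ F^k]$ (invertible elementary row operations), obtain $$Q^k_b=\begin{bmatrix} H_b^{k1} & F^{k1}\\ H_b^{k2} & F^{k2}\end{bmatrix},$$ where the first block column has $q_k$ columns, $F^{k2}$ has full row rank equal to $f_k$, and $F^{k1}=\mathbf{0}$. 3. Permute the first $q_k$ columns of $Q^k_b$ so that they take the form $$\begin{bmatrix} H_c^{k1} & H_c^{k3}\\ H_c^{k2} & H_c^{k4}\end{bmatrix},$$ where $H_c^{k1}$ is a square full rank block of dimension $q_k-f_k$. 4. Set $H^{k+1}=H_c^{k1}$, $F^{k+1}=[H_c^{k3}\ F^{k1}]$, $Q^{k+1}=[H^{k+1}\ F^{k+1}]$, $q_{k+1}=q_k-f_k$, and increase $k$ by one. When the loop ends, let $\bar k=k-1$. The output is the set of nodes associated with the columns of $H_c^{\bar k 1}=H^{\bar k+1}$ (if $F^1=\mathbf{0}$ or $F^1$ is empty, so that the loop is never entered, the output is the set of nodes associated with the columns of $H^1$). *)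

(* Defs.v *)
From HB Require Import structures.
From mathcomp Require Import all_boot all_order all_algebra perm.
From mathcomp Require Import all_classical all_reals all_analysis.
Set Implicit Arguments.
Unset Strict Implicit.
Unset Printing Implicit Defensive.
Import Order.TTheory GRing.Theory Num.Theory.
Import numFieldNormedType.Exports.
Local Open Scope ring_scope.

(* x is a classical solution of x' = A x + B u on [0, T]: continuous on [0, T]
   and differentiable on ]0, T[.  The equation is written componentwise.  No
   regularity is imposed on u beyond the existence of such an x; the values of
   x and u outside [0, T] are irrelevant. *)
Definition trajectory (R : realType) (N M : nat) (A : 'M[R]_N) (B : 'M[R]_(N, M))
    (T : R) (u : R -> 'cV[R]_M) (x : R -> 'cV[R]_N) : Prop :=
  forall i : 'I_N,
    {within `[0, T], continuous (fun s => x s i 0)}%classic /\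
    forall t : R, 0 < t < T ->
      is_derive t 1 (fun s => x s i 0) ((A *m x t + B *m u t) i 0).

(* The states (x_j)_(j in S) are determined on [0, T] by the input and by the
   output y = C x on [0, T]. *)
Definition simultaneously_observable (R : realType) (N M P : nat) (A : 'M[R]_N)
    (B : 'M[R]_(N, M)) (C : 'M[R]_(P, N)) (T : R) (S : {set 'I_N}) : Prop :=
  forall (u : R -> 'cV[R]_M) (x x' : R -> 'cV[R]_N),
    trajectory A B T u x -> trajectory A B T u x' ->
    (forall t : R, 0 <= t <= T -> C *m x t = C *m x' t) ->
    forall t : R, 0 <= t <= T -> forall j : 'I_N, j \in S -> x t j 0 = x' t j 0.

Definition node_observable (R : realType) (N M P : nat) (A : 'M[R]_N)
    (B : 'M[R]_(N, M)) (C : 'M[R]_(P, N)) (T : R) (j : 'I_N) : Prop :=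
  simultaneously_observable A B C T [set j]%SET.

Definition is_observable_node_set (R : realType) (N M P : nat) (A : 'M[R]_N)
    (B : 'M[R]_(N, M)) (C : 'M[R]_(P, N)) (T : R) (S : {set 'I_N}) : Prop :=
  simultaneously_observable A B C T S /\
  forall S' : {set 'I_N}, simultaneously_observable A B C T S' -> S' \subset S.

Lemma is_observable_node_setE (R : realType) (N M P : nat) (A : 'M[R]_N)
    (B : 'M[R]_(N, M)) (C : 'M[R]_(P, N)) (T : R) (S : {set 'I_N}) :
  is_observable_node_set A B C T S <->
  (forall j : 'I_N, j \in S <-> node_observable A B C T j).
Proof.
split=> [[obsS maxS] j | obsP]; split.
- move=> jS u x x' hx hx' hy t ht i; rewrite inE => /eqP ->.
  exact: obsS hx hx' hy t ht j jS.
- by move=> /maxS; rewrite finset.sub1set.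
- move=> u x x' hx hx' hy t ht j /obsP obsj.
  exact: obsj hx hx' hy t ht j (finset.set11 j).
- move=> S' obsS'; apply/fintype.subsetP => j jS'; apply/obsP.
  move=> u x x' hx hx' hy t ht i; rewrite inE => /eqP ->.
  exact: obsS' hx hx' hy t ht j jS'.
Qed.

(* The blocks C, CA, ..., CA^(N-1), from top to bottom. *)
Definition obs_mx (R : realType) (N P : nat) (A : 'M[R]_N) (C : 'M[R]_(P, N)) :
    'M[R]_(\sum_(k < N) P, N) :=
  \mxcol_(k < N) (C *m (A ^+ k)).

(* sel lists, in increasing order, the rows that do not lie in the span of the
   rows above them. *)
Definition first_independent_rows (R : realType) (m n q : nat) (O : 'M[R]_(m, n))
    (sel : 'I_q -> 'I_m) : Prop :=
  {homo sel : a b / (a < b)%N} /\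
  forall k : 'I_m,
    (exists a : 'I_q, sel a = k) <->
    ~~ (row k O <= \sum_(i < m | (i < k)%N) <<row i O>>)%MS.

(* The current Q^k = [H F], with the nodes associated with the columns of H and
   of F. *)
Record alg_state (R : realType) (N : nat) := AlgState {
  hdim : nat;
  fdim : nat;
  Hmx : 'M[R]_hdim;
  Fmx : 'M[R]_(hdim, fdim);
  Hnodes : 'rV['I_N]_hdim;
  Fnodes : 'rV['I_N]_fdim
}.

(* cols permutes the columns of the selected rows of O: its bijectivity forces
   q + r = N.  Column c of Q is column (cols c) of O. *)
Inductive alg_init (R : realType) (N P : nat) (A : 'M[R]_N) (C : 'M[R]_(P, N)) :
    alg_state R N -> Prop :=
| AlgInit (r : nat)
    (sel : 'I_(\rank (obs_mx A C)) -> 'I_(\sum_(k < N) P))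
    (cols : 'I_(\rank (obs_mx A C) + r) -> 'I_N) :
    first_independent_rows (obs_mx A C) sel ->
    bijective cols ->
    let Q := mxsub sel cols (obs_mx A C) in
    let nodes := \row_c cols c in
    lsubmx Q \in unitmx ->
    alg_init A C
      (AlgState (lsubmx Q) (rsubmx Q) (lsubmx nodes) (rsubmx nodes)).

(* One pass through the loop, where q_k = q' + f, so that q' = q_(k+1).  The
   matrix U collects the elementary row operations, s the permutation of the
   first q_k columns. *)
Inductive alg_step (R : realType) (N : nat) : alg_state R N -> alg_state R N -> Prop :=
| AlgStep (q' f r : nat) (H : 'M[R]_(q' + f)) (F : 'M[R]_(q' + f, r))
    (hn : 'rV['I_N]_(q' + f)) (fn : 'rV['I_N]_r)
    (U : 'M[R]_(q' + f)) (s : 'S_(q' + f)) :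
    F != 0 ->
    \rank F = f ->
    U \in unitmx ->
    usubmx (U *m F) = 0 ->
    row_free (dsubmx (U *m F)) ->
    let Hc := col_perm s (U *m H) in
    let hnc := col_perm s hn in
    ulsubmx Hc \in unitmx ->
    alg_step
      (AlgState H F hn fn)
      (AlgState (ulsubmx Hc) (row_mx (ursubmx Hc) (usubmx (U *m F)))
                (lsubmx hnc) (row_mx (rsubmx hnc) fn)).

(* The algorithm leaves choices open, so an execution is any sequence of
   admissible steps from any admissible initial state. *)
Inductive alg_reachable (R : realType) (N P : nat) (A : 'M[R]_N) (C : 'M[R]_(P, N)) :
    alg_state R N -> Prop :=
| ReachInit st : alg_init A C st -> alg_reachable A C st
| ReachStep st st' :
    alg_reachable A C st -> alg_step st st' -> alg_reachable A C st'.

(* The loop guard fails, in particular when F has no row or no column. *)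
Definition alg_final (R : realType) (N : nat) (st : alg_state R N) : Prop :=
  Fmx st = 0.

Definition alg_output (R : realType) (N : nat) (st : alg_state R N) : {set 'I_N} :=
  [set Hnodes st 0 a | a : 'I_(hdim st)]%SET.

(* Main.v *)
Require Import Defs.
From mathcomp Require Import all_boot all_order all_algebra perm.
From mathcomp Require Import all_classical all_reals all_analysis.
Import Order.TTheory GRing.Theory Num.Theory.
Local Open Scope ring_scope.

(** Both the set of observable nodes and the output of the algorithm are
    described by one condition: node j qualifies when the unit row vector e_j
    lies in the row space of the observability matrix O.

    Observability.  If e_j is a combination of the rows of the C A^k, then two
    trajectories with the same input and the same output agree at j, because
    their difference z satisfies z' = A z and C z = 0, hence C A^k z = 0 for all
    k (node_observable_of_span).  Otherwise some v with O v = 0 has v_j <> 0; by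
    Cayley-Hamilton C A^k v = 0 for all k, and the free motion exp(t A) v has
    zero output although its j-th component is initially nonzero
    (span_of_node_observable).

    Algorithm.  The initial Q = [H F] has the same row space as O up to the
    permutation of columns (alg_init_determined).  One pass through the loop
    keeps H invertible (alg_step_well_formed) and preserves the set of nodes
    whose unit vector lies in the row space: a unit vector in the row space
    cannot use the rows that the pass deletes (alg_step_determined).  At the end
    F = 0 with H invertible, so the unit vectors of the row space are exactly
    those of the columns of H (alg_outputP).

    Each pass removes rank F > 0 rows, so executions are finite; and every choice
    demanded by a pass is possible by Gaussian elimination and by extracting
    independent columns (alg_step_exists). *)

Import numFieldNormedType.Exports.
Set Implicit Arguments.
Unset Strict Implicit.
Unset Printing Implicit Defensive.

(** * Selecting rows and columns *)

Lemma mxrank_adds_row (F : fieldType) (m n : nat) (V : 'M[F]_(m, n))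
    (v : 'rV[F]_n) :
  \rank (V + v)%MS = (\rank V + ~~ (v <= V)%MS)%N.
Proof.
have [vV | nvV] /= := boolP (v <= V)%MS.
  by rewrite addn0; apply: eqmx_rank; rewrite addsmx_sub submx_refl vV addsmxSl.
apply/eqP; rewrite eqn_leq; apply/andP; split.
  rewrite (leq_trans (mxrank_adds_leqif V v)) // leq_add2l.
  exact: rank_leq_row.
rewrite addn1; apply: rank_ltmx; rewrite /ltmx addsmxSl /=.
by apply: contra nvV => /(submx_trans (addsmxSr V v)).
Qed.

Lemma mxrank_prefix (F : fieldType) (m n : nat) (O : 'M[F]_(m, n)) (t : nat) :
  (t <= m)%N ->
  \rank (\sum_(i < m | (i < t)%N) <<row i O>>)%MS =
  (\sum_(k < m | (k < t)%N)
     ~~ (row k O <= \sum_(i < m | (i < k)%N) <<row i O>>)%MS)%N.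
Proof.
elim: t => [_|t IH lt_tm]; first by rewrite !big_pred0 ?mxrank0.
pose k0 := Ordinal lt_tm.
have ltS (i : 'I_m) : (i < t.+1)%N && (i != k0) = (i < t)%N.
  by rewrite ltnS [RHS]ltn_neqAle andbC.
rewrite [RHS](bigD1 k0) //= (eq_bigl _ _ ltS) -(IH (ltnW lt_tm)) addnC.
rewrite -mxrank_adds_row; apply: eqmx_rank; apply/eqmxP.
rewrite [X in (X :=: _)%MS](bigD1 k0) //= (eq_bigl _ _ ltS).
apply: eqmx_trans (adds_eqmx (genmxE _) (eqmx_refl _)) _.
by rewrite addsmxC.
Qed.

(** The independent rows are as many as the rank because each row raises the rank
    of the span of the rows above it by one or by zero. *)
Lemma first_independent_rows_exists (R : realType) (m n : nat)
    (O : 'M[R]_(m, n)) :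
  exists sel : 'I_(\rank O) -> 'I_m, first_independent_rows O sel.
Proof.
pose P := [pred k : 'I_m |
  ~~ (row k O <= \sum_(i < m | (i < k)%N) <<row i O>>)%MS].
have rankE : \rank O = #|P|.
  have eT (V : 'I_m -> 'M[R]_n) :
      (\sum_(i < m | (i < m)%N) V i)%MS = (\sum_i V i)%MS.
    by apply: eq_bigl => i; rewrite ltn_ord.
  have -> : \rank O = \rank (\sum_i <<row i O>>)%MS.
    apply: eqmx_rank; apply/andP; split.
      by apply/row_subP => i; apply: (sumsmx_sup i); rewrite ?genmxE.
    by apply/sumsmx_subP => i _; rewrite genmxE row_sub.
  rewrite -eT mxrank_prefix // -sum1_card [RHS]big_mkcond /=.
  by apply: eq_big => [i | i _]; rewrite ?ltn_ord //= inE; case: (_ <= _)%MS.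
have size_s : size [seq k <- enum 'I_m | P k] == \rank O.
  rewrite rankE cardE /enum_mem -filter_predI; apply/eqP/congr1/eq_filter => k.
  by rewrite /= andbT.
pose t := Tuple size_s; exists (tnth t); split=> [a b lt_ab | k].
  have k0 := tnth t a; rewrite !(tnth_nth k0).
  have lt_trans : transitive (fun i j : 'I_m => (i < j)%N).
    by move=> ? ? ?; apply: ltn_trans.
  apply: (sorted_ltn_nth lt_trans) => //; rewrite ?inE ?(eqP size_s) //.
  by apply: sorted_filter => //; have := iota_ltn_sorted 0 m;
    rewrite -val_enum_ord sorted_map.
have -> : ~~ (row k O <= \sum_(i < m | (i < k)%N) <<row i O>>)%MS = (k \in t).
  by rewrite mem_filter mem_enum andbT.
by split=> [[a <-] | /tnthP[a ->]]; [exact: mem_tnth | exists a].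
Qed.

(** By strong induction on the index, a discarded row lies in the span of earlier
    rows, hence of the selected ones. *)
Lemma first_independent_rows_span (R : realType) (m n q : nat)
    (O : 'M[R]_(m, n)) (sel : 'I_q -> 'I_m) :
  first_independent_rows O sel -> (rowsub sel O :=: O)%MS.
Proof.
case=> _ selP; apply/eqmxP; rewrite rowsub_sub /=; apply/row_subP => k.
elim/ltn_ind: {k}(k : nat) {-2}k (erefl (k : nat)) => t IH k kt.
have [prev | /selP[a <-]] :=
  boolP (row k O <= \sum_(i < m | (i < k)%N) <<row i O>>)%MS; last first.
  by rewrite -row_rowsub row_sub.
apply: submx_trans prev _; apply/sumsmx_subP => i lt_ik.
by rewrite genmxE; apply: IH (erefl _); rewrite -kt.
Qed.

(** This is the choice of H in Q = [H F]: q independent columns come first, the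
    others follow in any order. *)
Lemma column_basis_exists (F : fieldType) (q n : nat) (M : 'M[F]_(q, n)) :
  row_free M ->
  exists r (cols : 'I_(q + r) -> 'I_n),
    bijective cols /\ lsubmx (colsub cols M) \in unitmx.
Proof.
move=> freeM; have fullMT : row_full M^T by rewrite /row_full mxrank_tr.
pose f := fullrankfun fullMT; pose D := ~: [set f a | a : 'I_q]%SET.
have cardD : (q + #|D| = n)%N.
  rewrite /D cardsCs finset.setCK card_imset; last exact: fullrankfun_inj.
  by rewrite !card_ord subnKC // -{1}(eqP freeM) rank_leq_col.
pose cols (c : 'I_(q + #|D|)) :=
  match fintype.split c with inl a => f a | inr b => enum_val b end.
exists #|D|, cols; split.
  apply: inj_card_bij; last by rewrite !card_ord cardD.
  have nfD a (b : 'I_#|D|) : f a <> enum_val b.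
    by move=> e; have := enum_valP b; rewrite -e finset.inE imset_f.
  move=> c c'; rewrite /cols.
  case: splitP => [a ca|b cb]; case: splitP => [a' ca'|b' cb'].
  - by move=> /fullrankfun_inj e; apply: val_inj; rewrite /= ca ca' e.
  - by move=> /nfD.
  - by move=> /esym/nfD.
  - by move=> /enum_val_inj e; apply: val_inj; rewrite /= cb cb' e.
suff -> : lsubmx (colsub cols M) = (rowsub f M^T)^T.
  by rewrite unitmx_tr fullrowsub_unit.
apply/matrixP => i a; rewrite !mxE; congr (M _ _).
by rewrite /cols; case: splitP => [b /= /ord_inj ->|b /= e] //;
   have := ltn_ord a; rewrite e ltnNge leq_addr.
Qed.

Lemma column_perm_exists (F : fieldType) (q f : nat) (M : 'M[F]_(q, q + f)) :
  row_free M -> exists s : 'S_(q + f), lsubmx (col_perm s M) \in unitmx.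
Proof.
move=> /column_basis_exists[r [cols [bijc unitc]]].
have er : r = f.
  by have := bij_eq_card bijc; rewrite !card_ord => /addnI.
subst r; exists (perm (bij_inj bijc)).
suff -> : col_perm (perm (bij_inj bijc)) M = colsub cols M by [].
by apply/matrixP=> i j; rewrite !mxE permE.
Qed.

(** Gaussian elimination writes M as L D V with L, V invertible and D a partial
    identity, so the nonzero rows of L^-1 M are the first f ones; reversing the
    order of the rows moves them to the bottom.  They are then independent
    because their number is the rank of M. *)
Lemma row_elim_exists (F : fieldType) (q f r : nat) (M : 'M[F]_(q + f, r)) :
  \rank M = f ->
  exists2 U, U \in unitmx &
    usubmx (U *m M) = 0 /\ row_free (dsubmx (U *m M)).
Proof.
move=> rkM; pose p := perm (@rev_ord_inj (q + f)).
pose U := perm_mx p *m invmx (col_ebase M).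
have unitU : U \in unitmx.
  by rewrite unitmx_mul unitmx_perm unitmx_inv col_ebase_unit.
have EU : U *m M = row_perm p (pid_mx (\rank M) *m row_ebase M).
  rewrite row_permE /U -mulmxA; congr (_ *m _).
  by apply: (canLR (mulKmx (col_ebase_unit M))); rewrite mulmxA mulmx_ebase.
have U0 : usubmx (U *m M) = 0.
  apply/matrixP => i j; rewrite EU !mxE big1 // => k _.
  rewrite mxE permE /= rkM ltnNge.
  rewrite [(f <= _)%N](_ : _ = true) ?andbF ?mul0r //.
  by rewrite addnC -addnBA ?leq_addr.
exists U => //; split => //.
have eD : (U *m M :=: dsubmx (U *m M))%MS.
  rewrite -{1}[U *m M]vsubmxK U0.
  exact: eqmx_trans (eqmx_sym (addsmxE _ _)) (adds0mx _ _).
by rewrite /row_free -eD (eqmxMfull M) ?rkM ?row_full_unit.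
Qed.

(** * States of the algorithm *)

Definition node_labels (R : realType) (N : nat) (st : alg_state R N) :
    'rV['I_N]_(hdim st + fdim st) :=
  row_mx (Hnodes st) (Fnodes st).

Definition state_mx (R : realType) (N : nat) (st : alg_state R N) :
    'M[R]_(hdim st, hdim st + fdim st) :=
  row_mx (Hmx st) (Fmx st).

Definition indicator_row (R : realType) (N n : nat) (labels : 'rV['I_N]_n)
    (j : 'I_N) : 'rV[R]_n :=
  map_mx (fun i => (i == j)%:R) labels.

(** Up to the relabelling of the columns, the unit row vector of node j lies in
    the row space of the current matrix [H F].  This is the quantity that the
    algorithm preserves. *)
Definition determined (R : realType) (N : nat) (st : alg_state R N) (j : 'I_N) :
    bool :=
  (indicator_row R (node_labels st) j <= state_mx st)%MS.

(** Together with the equality of dimensions, surjectivity of the labelling makes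
    it a bijection between columns and nodes. *)
Definition well_formed (R : realType) (N : nat) (st : alg_state R N) : Prop :=
  [/\ Hmx st \in unitmx, (hdim st + fdim st)%N = N &
      forall j, exists c, node_labels st 0 c = j].

Lemma indicator_row_eq0 (R : realType) (N n : nat) (labels : 'rV['I_N]_n)
    (j : 'I_N) :
  (forall a, labels 0 a <> j) -> indicator_row R labels j = 0.
Proof.
by move=> nj; apply/rowP => a; rewrite !mxE; case: eqP => // /nj.
Qed.

Lemma indicator_row_col_perm (R : realType) (N n : nat) (labels : 'rV['I_N]_n)
    (s : 'S_n) (j : 'I_N) :
  indicator_row R (col_perm s labels) j = col_perm s (indicator_row R labels j).
Proof. exact: map_col_perm. Qed.

Lemma row_mx_entry (T : Type) (m n : nat) (x : 'rV[T]_m) (y : 'rV[T]_n)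
    (c : 'I_(m + n)) :
  (exists a, x 0 a = row_mx x y 0 c) \/ (exists b, y 0 b = row_mx x y 0 c).
Proof.
rewrite mxE; case: fintype.splitP => k _; first by left; exists k.
by right; exists k.
Qed.

Lemma node_labels_inj (R : realType) (N : nat) (st : alg_state R N) :
  well_formed st -> injective (node_labels st 0).
Proof.
move=> [_ dimN onto] c c' e.
have /image_injP inj :
    #|fintype.image (node_labels st 0) predT| == #|'I_(hdim st + fdim st)|.
  have -> : #|'I_(hdim st + fdim st)| = #|'I_N| by rewrite !card_ord.
  apply/eqP/eq_card => j.
  by rewrite inE; have [d <-] := onto j; rewrite fintype.image_f.
exact: inj e.
Qed.

Lemma Hnodes_neq_Fnodes (R : realType) (N : nat) (st : alg_state R N) a b :
  well_formed st -> Hnodes st 0 a <> Fnodes st 0 b.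
Proof.
move=> /node_labels_inj inj e.
have /inj/eqP : node_labels st 0 (lshift _ a) = node_labels st 0 (rshift _ b).
  by rewrite /node_labels row_mxEl row_mxEr.
by rewrite eq_lrshift.
Qed.

Lemma Hnodes_or_Fnodes (R : realType) (N : nat) (st : alg_state R N) j :
  well_formed st ->
  (exists a, Hnodes st 0 a = j) \/ (exists b, Fnodes st 0 b = j).
Proof.
by move=> [_ _ /(_ j) [c <-]]; apply: row_mx_entry.
Qed.

Lemma determinedP (R : realType) (N : nat) (st : alg_state R N) j :
  reflect (exists2 w, w *m Hmx st = indicator_row R (Hnodes st) j &
                      w *m Fmx st = indicator_row R (Fnodes st) j)
    (determined st j).
Proof.
rewrite /determined /state_mx /indicator_row /node_labels map_row_mx.
apply: (iffP submxP) => [[w] | [w <- <-]]; last by exists w; rewrite mul_mx_row.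
by rewrite mul_mx_row => /eq_row_mx[-> ->]; exists w.
Qed.

(** When F = 0, the row space of [H 0] with H invertible consists of all row
    vectors supported on the first columns. *)
Lemma alg_outputP (R : realType) (N : nat) (st : alg_state R N) j :
  well_formed st -> alg_final st -> (j \in alg_output st) = determined st j.
Proof.
move=> wf; have [unitH _ _] := wf; rewrite /alg_final => F0.
apply/imsetP/determinedP => [[a _ ->] | [w wH wF]].
  exists (indicator_row R (Hnodes st) (Hnodes st 0 a) *m invmx (Hmx st)).
    by rewrite mulmxKV.
  rewrite F0 mulmx0 indicator_row_eq0 // => b /esym.
  exact: Hnodes_neq_Fnodes.
have [[a <-] | [b bj]] := Hnodes_or_Fnodes j wf; first by exists a.
have /rowP/(_ b)/eqP := wF; rewrite F0 mulmx0 !mxE bj eqxx.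
by rewrite eq_sym oner_eq0.
Qed.

(** * One pass through the loop *)

Lemma mul_row_mx0 (R : pzRingType) (p q n : nat) (a : 'rV[R]_p)
    (X : 'M[R]_(p + q, n)) :
  row_mx a 0 *m X = a *m usubmx X.
Proof. by rewrite -{1}[X]vsubmxK mul_row_col mul0mx addr0. Qed.

Lemma mul_col_perm (R : pzRingType) (m n p : nat) (A : 'M[R]_(m, n))
    (B : 'M[R]_(n, p)) (s : 'S_p) :
  A *m col_perm s B = col_perm s (A *m B).
Proof. by rewrite !col_permE mulmxA. Qed.

Lemma col_perm_inj (T : Type) (m n : nat) (s : 'S_n) :
  injective (@col_perm T m n s).
Proof.
move=> A B e; apply/matrixP => i j.
by have /matrixP/(_ i ((s^-1)%g j)) := e; rewrite !mxE permKV.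
Qed.

Lemma alg_step_hdim (R : realType) (N : nat) (st st' : alg_state R N) :
  alg_step st st' -> (hdim st' < hdim st)%N.
Proof.
case=> q f r H F hn fn U s F0 rkF *.
by rewrite /= -[X in (X < _)%N]addn0 ltn_add2l -rkF lt0n mxrank_eq0.
Qed.

Lemma alg_step_well_formed (R : realType) (N : nat) (st st' : alg_state R N) :
  alg_step st st' -> well_formed st -> well_formed st'.
Proof.
case=> q f r H F hn fn U s _ _ _ _ _ Hc hnc unitH' [/= _ dimN onto].
split => //=; first by rewrite addnA.
move=> j; have [c <-] := onto j; rewrite /node_labels /=.
have [[a <-] | [b <-]] := row_mx_entry hn fn c; last first.
  by exists (rshift _ (rshift _ b)); rewrite !row_mxEr.
have -> : hn 0 a = row_mx (lsubmx hnc) (rsubmx hnc) 0 ((s^-1)%g a).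
  by rewrite hsubmxK mxE permKV.
have [[k <-] | [k <-]] := row_mx_entry (lsubmx hnc) (rsubmx hnc) ((s^-1)%g a).
  by exists (lshift _ k); rewrite row_mxEl.
by exists (rshift _ (lshift _ k)); rewrite row_mxEr row_mxEl.
Qed.

(** After the row operations the matrix is [H1 H3 0; H2 H4 F2] with F2 of full row
    rank.  A combination of its rows equal to a unit vector cannot involve the
    lower rows: if the unit vector sits in an H column, the F part vanishes and
    F2 has independent rows; if it sits in an F column, the H part vanishes and
    H is invertible, so the combination is trivial.  Dropping the lower rows
    thus loses no unit vector. *)
Lemma alg_step_determined (R : realType) (N : nat) (st st' : alg_state R N) j :
  alg_step st st' -> well_formed st -> determined st' j = determined st j.
Proof.
case=> q f r H F hn fn U s _ _ unitU UF0 freeD Hc hnc _ wf.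
have [/= unitH _ _] := wf.
pose ind n (labels : 'rV['I_N]_n) := indicator_row R labels j.
have indHc : ind _ hnc = col_perm s (ind _ hn) by exact: indicator_row_col_perm.
apply/determinedP/determinedP => /= [[a aH aF] | [w wH wF]].
  move: aF; rewrite mul_mx_row /indicator_row map_row_mx => /eq_row_mx[aH3 aF].
  exists (row_mx a 0 *m U); rewrite -mulmxA mul_row_mx0 //.
  apply: (@col_perm_inj _ _ _ s); rewrite -mul_col_perm -indicator_row_col_perm.
  have -> : col_perm s (usubmx (U *m H)) = usubmx Hc.
    by apply/matrixP=> i k; rewrite !mxE.
  by rewrite -[usubmx Hc]hsubmxK mul_mx_row aH aH3 -map_row_mx hsubmxK.
pose w' := w *m invmx U; pose a := lsubmx w'; pose b := rsubmx w'.
have wE : w = w' *m U by rewrite mulmxKV.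
have w'E : w' = row_mx a b by rewrite hsubmxK.
have w'F : w' *m (U *m F) = b *m dsubmx (U *m F).
  by rewrite -{1}[U *m F]vsubmxK w'E mul_row_col UF0 mulmx0 add0r.
have disj c d : hn 0 c <> fn 0 d :=
  @Hnodes_neq_Fnodes R N (AlgState H F hn fn) c d wf.
(* The column blocks carry disjoint sets of nodes, so one of w H, w F is zero:
   either b (U F)_2 = w F = 0, or w itself is zero. *)
have b0 : b = 0.
  have [[c cj] | [c cj]] := Hnodes_or_Fnodes j wf.
    apply: (row_free_inj freeD); rewrite mul0mx -w'F mulmxA -wE wF.
    apply: indicator_row_eq0 => d dj; case: (disj c d).
    by rewrite cj dj.
  suff w0 : w = 0 by rewrite /b /w' w0 mul0mx linear0.
  apply: (can_inj (mulmxK unitH)); rewrite mul0mx wH.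
  apply: indicator_row_eq0 => d dj; case: (disj d c).
  by rewrite cj dj.
have aX n (X : 'M[R]_(_, n)) : a *m usubmx X = w' *m X.
  by rewrite w'E b0 mul_row_mx0.
have aHc : row_mx (a *m ulsubmx Hc) (a *m ursubmx Hc) = ind _ hnc.
  rewrite -mul_mx_row hsubmxK aX mul_col_perm mulmxA -wE wH.
  by rewrite indHc.
rewrite -[hnc]hsubmxK /ind /indicator_row map_row_mx in aHc.
have [aH1 aH3] := eq_row_mx aHc; exists a; first exact: aH1.
rewrite mul_mx_row aH3 aX mulmxA -wE wF.
by rewrite /indicator_row map_row_mx.
Qed.

(** The upper rows of the invertible matrix U H are independent, hence contain
    an invertible block of columns. *)
Lemma alg_step_exists (R : realType) (N : nat) (st : alg_state R N) :
  well_formed st -> ~ alg_final st -> exists st', alg_step st st'.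
Proof.
case: st => n r H F hn fn [/= unitH _ _]; rewrite /alg_final /= => /eqP F0.
have [q dimE] : exists q, n = (q + \rank F)%N.
  by exists (n - \rank F)%N; rewrite subnK ?rank_leq_row.
have [f rkF] : exists f, \rank F = f by exists (\rank F).
rewrite rkF in dimE; subst n.
have [U unitU [UF0 freeD]] := row_elim_exists rkF.
have [s unitHc] : exists s : 'S_(q + f),
    lsubmx (col_perm s (usubmx (U *m H))) \in unitmx.
  apply: column_perm_exists.
  have : row_free (U *m H) by rewrite row_free_unit unitmx_mul unitU.
  rewrite -!kermx_eq0 => /eqP ker0; apply/rowV0P => a /sub_kermxP aUH.
  have : (row_mx a 0 <= kermx (U *m H))%MS.
    by apply/sub_kermxP; rewrite mul_row_mx0.
  rewrite ker0 submx0 => /eqP /(congr1 lsubmx).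
  by rewrite row_mxKl linear0.
eexists; apply: (AlgStep _ _ F0 rkF unitU UF0 freeD (s := s)).
suff -> : ulsubmx (col_perm s (U *m H)) = lsubmx (col_perm s (usubmx (U *m H))).
  exact: unitHc.
by apply/matrixP => i k; rewrite !mxE.
Qed.

Lemma no_infinite_run (R : realType) (N : nat) (sts : nat -> alg_state R N) :
  ~ (forall k : nat, alg_step (sts k) (sts k.+1)).
Proof.
move=> steps.
have dec k : (hdim (sts k) + k <= hdim (sts 0%N))%N.
  elim: k => [|k]; first by rewrite addn0.
  by apply: leq_trans; rewrite addnS -addSn leq_add2r; apply: alg_step_hdim.
by have := dec (hdim (sts 0%N)).+1; rewrite addnS ltnNge leq_addl.
Qed.

(** * Initial states and executions *)

Lemma alg_init_exists (R : realType) (N P : nat) (A : 'M[R]_N)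
    (C : 'M[R]_(P, N)) :
  exists st, alg_init A C st.
Proof.
have [sel indep] := first_independent_rows_exists (obs_mx A C).
have freeQ : row_free (rowsub sel (obs_mx A C)).
  by rewrite /row_free (first_independent_rows_span indep).
have [r [cols [bijc unitH]]] := column_basis_exists freeQ.
eexists; apply: (AlgInit indep bijc).
suff -> : mxsub sel cols (obs_mx A C) = colsub cols (rowsub sel (obs_mx A C)).
  exact: unitH.
by apply/matrixP => i k; rewrite !mxE.
Qed.

Lemma alg_init_well_formed (R : realType) (N P : nat) (A : 'M[R]_N)
    (C : 'M[R]_(P, N)) st :
  alg_init A C st -> well_formed st.
Proof.
case=> r sel cols _ bijc Q nodes unitH; split => //=.
  by have := bij_eq_card bijc; rewrite !card_ord.
move=> j; have [g _ gK] := bijc; exists (g j).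
by rewrite /node_labels /= hsubmxK mxE gK.
Qed.

Lemma alg_init_determined (R : realType) (N P : nat) (A : 'M[R]_N)
    (C : 'M[R]_(P, N)) st j :
  alg_init A C st -> determined st j = ((delta_mx 0 j : 'rV[R]_N) <= obs_mx A C)%MS.
Proof.
case=> r sel cols indep bijc Q nodes unitH; have [g colsK gK] := bijc.
have QE : Q = colsub cols (rowsub sel (obs_mx A C)).
  by apply/matrixP => i k; rewrite !mxE.
transitivity ((delta_mx 0 j : 'rV[R]_N) <= rowsub sel (obs_mx A C))%MS; last first.
  by rewrite (first_independent_rows_span indep).
rewrite /determined /state_mx /node_labels /= !hsubmxK.
have -> : indicator_row R nodes j = colsub cols (delta_mx 0 j).
  by apply/rowP => c; rewrite !mxE eqxx.
rewrite QE; apply/submxP/submxP => -[w]; last first.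
  by move=> ->; exists w; rewrite mulmx_colsub.
rewrite mulmx_colsub => e; exists w; apply/rowP => c.
by have /rowP/(_ (g c)) := e; rewrite !mxE !gK.
Qed.

Lemma alg_reachable_invariant (R : realType) (N P : nat) (A : 'M[R]_N)
    (C : 'M[R]_(P, N)) (st : alg_state R N) :
  alg_reachable A C st ->
  well_formed st /\
  forall j, determined st j = ((delta_mx 0 j : 'rV[R]_N) <= obs_mx A C)%MS.
Proof.
elim=> {st} [st init | st st' _ [wf detE] step].
  by split; [apply: alg_init_well_formed init | move=> j; apply: alg_init_determined].
split; first exact: alg_step_well_formed step wf.
by move=> j; rewrite (alg_step_determined j step wf).
Qed.

(** * Observable nodes and the row space of the observability matrix *)

(** The output equation can be differentiated only inside the interval;
    continuity then carries the conclusion to its end points. *)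
Lemma within_continuous_eq0 (R : realType) (T : R) (f : R -> R) :
  0 < T -> {within `[0, T], continuous f}%classic ->
  (forall t, 0 < t < T -> f t = 0) -> forall t, 0 <= t <= T -> f t = 0.
Proof.
move=> T0 /(continuous_within_itvP _ T0)[_ f0 fT] fz t /andP[].
have f00 : f 0 = 0.
  apply: (cvg_unique (@norm_hausdorff _ R) f0); apply: cvg_near_cst.
  near=> s; apply: fz; apply/andP; split; near: s.
    exact: nbhs_right_gt.
  exact: nbhs_right_lt.
have fTT : f T = 0.
  apply: (cvg_unique (@norm_hausdorff _ R) fT); apply: cvg_near_cst.
  near=> s; apply: fz; apply/andP; split; near: s.
    exact: nbhs_left_gt.
  exact: nbhs_left_lt.
rewrite le_eqVlt => /predU1P[<- //|t0].
rewrite le_eqVlt => /predU1P[-> //|tT].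
by apply: fz; rewrite t0.
Unshelve. all: by end_near.
Qed.

Lemma is_derive_mulmx (R : realType) (N p : nat) (D : 'M[R]_(p, N))
    (z : R -> 'cV[R]_N) (t : R) (dz : 'cV[R]_N) (i : 'I_p) :
  (forall l, is_derive t (1 : R) (fun s => z s l 0) (dz l 0)) ->
  is_derive t (1 : R) (fun s => (D *m z s) i 0) ((D *m dz) i 0).
Proof.
move=> hz.
have -> : (fun s => (D *m z s) i 0) = \sum_(l < N) (D i l \*: (fun s => z s l 0)).
  by apply/funext => s; rewrite mxE fct_sumE.
by rewrite mxE; apply: is_derive_sum.
Qed.

(** Differentiate D z = 0 and use z' = A z. *)
Lemma annihilator_mulA (R : realType) (N p : nat) (A : 'M[R]_N) (T : R)
    (z : R -> 'cV[R]_N) (D : 'M[R]_(p, N)) :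
  (forall t, 0 < t < T -> forall l,
     is_derive t (1 : R) (fun s => z s l 0) ((A *m z t) l 0)) ->
  (forall t, 0 < t < T -> D *m z t = 0) ->
  forall t, 0 < t < T -> D *m A *m z t = 0.
Proof.
move=> hz Dz t ht; apply/colP => i; rewrite -mulmxA.
have [_ <-] := is_derive_mulmx D i (hz t ht).
rewrite (near_eq_derive (g := cst 0)) ?derive_cst ?mxE //.
have tin : t \in `]0, T[ by rewrite in_itv.
near=> s; rewrite Dz ?mxE //.
by rewrite -[_ < _ < _]/(s \in `]0, T[); near: s; exact: near_in_itvoo.
Unshelve. all: by end_near.
Qed.

Lemma trajectory_sub (R : realType) (N M : nat) (A : 'M[R]_N)
    (B : 'M[R]_(N, M)) (T : R) u x x' t l :
  trajectory A B T u x -> trajectory A B T u x' -> 0 < t < T ->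
  is_derive t (1 : R) (fun s => (x s - x' s) l 0) ((A *m (x t - x' t)) l 0).
Proof.
move=> hx hx' ht; have [_ /(_ t ht) dx] := hx l; have [_ /(_ t ht) dx'] := hx' l.
have -> : (fun s => (x s - x' s) l 0) = (fun s => x s l 0) - (fun s => x' s l 0).
  by apply/funext => s; rewrite !mxE.
apply: is_derive_eq (is_deriveB dx dx') _.
by rewrite mulmxBr !mxE opprD addrACA subrr addr0.
Qed.

(** The difference z of two trajectories with equal inputs satisfies z' = A z, so
    C z = 0 gives C A^k z = 0 for every k by repeated differentiation, and the
    unit row vector of j is a combination of the rows of the C A^k. *)
Lemma node_observable_of_span (R : realType) (N M P : nat) (A : 'M[R]_N)
    (B : 'M[R]_(N, M)) (C : 'M[R]_(P, N)) (T : R) (j : 'I_N) :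
  0 < T -> ((delta_mx 0 j : 'rV[R]_N) <= obs_mx A C)%MS ->
  node_observable A B C T j.
Proof.
move=> T0 /submxP[w wO] u x x' hx hx' hy t ht i; rewrite finset.inE => /eqP ->.
pose z s := x s - x' s.
have dz s : 0 < s < T -> forall l,
    is_derive s (1 : R) (fun r => z r l 0) ((A *m z s) l 0).
  by move=> hs l; apply: trajectory_sub hx hx' hs.
have CAz k s : 0 < s < T -> C *m A ^+ k *m z s = 0.
  elim: k s => [|k IH] s hs.
    rewrite expr0 mulmx1 mulmxBr hy ?subrr //.
    by case/andP: hs => /ltW -> /ltW ->.
  by rewrite exprSr mulmxA; apply: annihilator_mulA dz IH s hs.
have zj s : 0 < s < T -> x s j 0 - x' s j 0 = 0.
  move=> hs; have -> : x s j 0 - x' s j 0 = ((delta_mx 0 j : 'rV[R]_N) *m z s) 0 0.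
    by rewrite -rowE !mxE.
  rewrite wO -mulmxA mxcol_mul (_ : \mxcol_k _ = 0) ?mulmx0 ?mxE //.
  by rewrite -mxcol0; apply: eq_mxcol => k; rewrite CAz.
apply/eqP; rewrite -subr_eq0; apply/eqP.
apply: (within_continuous_eq0 (f := fun s => x s j 0 - x' s j 0) T0 _ zj ht).
have [cx _] := hx j; have [cx' _] := hx' j.
by move=> s; apply: continuousB; [apply: cx | apply: cx'].
Qed.

(** By the Cayley-Hamilton theorem every power of A is a combination of the first
    N ones. *)
Lemma mulmx_expr_obs_ker (R : realType) (N P : nat) (A : 'M[R]_N)
    (C : 'M[R]_(P, N)) (v : 'cV[R]_N) k :
  obs_mx A C *m v = 0 -> C *m A ^+ k *m v = 0.
Proof.
case: N A C v => [|n] A C v; first by rewrite [v]flatmx0 !mulmx0.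
rewrite mxcol_mul -mxcol0 => /eq_mxcolP Ov.
pose r := 'X^k %% char_poly A.
have size_r : (size r <= n.+1)%N.
  by rewrite -ltnS -(size_char_poly A) ltn_modp -size_poly_eq0 size_char_poly.
have -> : A ^+ k = vec_mx (poly_rV r *m powers_mx A n.+1).
  rewrite -horner_rVpoly poly_rV_K // -[A in LHS](horner_mx_X A) -rmorphXn /=.
  by rewrite (divp_eq 'X^k (char_poly A)) rmorphD rmorphM /= Cayley_Hamilton
    mulr0 add0r.
rewrite mulmx_sum_row linear_sum mulmx_sumr mulmx_suml big1 // => i _.
by rewrite linearZ /= rowK mxvecK -scalemxAr -scalemxAl Ov scaler0.
Qed.

Definition flow_coef (R : realType) (N : nat) (A : 'M[R]_N) (v : 'cV[R]_N)
    (l : 'I_N) (k : nat) : R := (A ^+ k *m v) l 0 / k`!%:R.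

(** The solution exp(t A) v of z' = A z with z(0) = v, by its power series. *)
Definition flow (R : realType) (N : nat) (A : 'M[R]_N) (v : 'cV[R]_N) (t : R) :
    'cV[R]_N :=
  \col_l limn (pseries (flow_coef A v l) t).

Lemma flow_coef_diffs (R : realType) (N : nat) (A : 'M[R]_N) (v : 'cV[R]_N) l :
  pseries_diffs (flow_coef A v l) = flow_coef A (A *m v) l.
Proof.
apply/funext => k; rewrite /pseries_diffs /flow_coef exprSr mulmxA.
by rewrite factS natrM invfM mulrCA mulVKf ?pnatr_eq0.
Qed.

(** The constant a, the sum of all absolute values of entries of A, bounds every
    row sum of A. *)
Lemma norm_expr_mulmx_le (R : realType) (N : nat) (A : 'M[R]_N) (v : 'cV[R]_N) :
  exists a b, [/\ 0 <= a, 0 <= b &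
    forall k l, `|(A ^+ k *m v) l 0| <= b * a ^+ k].
Proof.
pose a := \sum_i \sum_l `|A i l|; pose b := \sum_l `|v l 0|.
have a0 : 0 <= a by apply: sumr_ge0 => i _; apply: sumr_ge0.
have b0 : 0 <= b by apply: sumr_ge0.
exists a, b; split=> //; elim=> [|k IH] l.
  rewrite expr0 mul1mx expr0 mulr1 /b (bigD1 l) //= lerDl; exact: sumr_ge0.
rewrite exprS -mulmxA mxE (le_trans (ler_norm_sum _ _ _)) //.
rewrite exprS mulrCA (@le_trans _ _ (\sum_i `|A l i| * (b * a ^+ k))) //.
  by apply: ler_sum => i _; rewrite normrM ler_wpM2l.
rewrite -mulr_suml ler_wpM2r ?mulr_ge0 ?exprn_ge0 //.
rewrite /a [leRHS](bigD1 l) //= lerDl; apply: sumr_ge0 => i _; exact: sumr_ge0.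
Qed.

Lemma flow_cvg (R : realType) (N : nat) (A : 'M[R]_N) (v : 'cV[R]_N) l t :
  cvgn (pseries (flow_coef A v l) t).
Proof.
have [a [b [a0 b0 le_ab]]] := norm_expr_mulmx_le A v.
apply: normed_cvg; apply: (@series_le_cvg _ _ (b *: exp_coeff (a * `|t|))).
- by move=> k; apply: normr_ge0.
- by move=> k; apply: mulr_ge0 => //; apply: exp_coeff_ge0; rewrite mulr_ge0.
- move=> k.
  have -> : (b *: exp_coeff (a * `|t|)) k = b * a ^+ k / k`!%:R * `|t| ^+ k.
    rewrite fctE /exp_coeff /= exprMn /GRing.scale /=.
    by rewrite -!mulrA; congr (_ * (_ * _)); rewrite mulrC.
  rewrite /= /flow_coef !normrM normrX normfV normr_nat.
  by rewrite !ler_wpM2r ?exprn_ge0 ?invr_ge0.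
by apply: is_cvg_seriesZ; exact: is_cvg_series_exp_coeff.
Qed.

(** A finite combination of the component series is computed termwise.  With D = C
    this shows that the output vanishes, with D = A it gives the derivative. *)
Lemma mulmx_flow (R : realType) (N p : nat) (A : 'M[R]_N) (v : 'cV[R]_N)
    (D : 'M[R]_(p, N)) i t :
  (D *m flow A v t) i 0 =
  limn (pseries (fun k => (D *m A ^+ k *m v) i 0 / k`!%:R) t).
Proof.
apply/esym/cvg_lim => //.
have -> : pseries (fun k => (D *m A ^+ k *m v) i 0 / k`!%:R) t =
    (fun n => \sum_(l < N) (D i l * pseries (flow_coef A v l) t n)).
  apply/funext => n; rewrite /pseries /series /=.
  under [RHS]eq_bigr do rewrite mulr_sumr.
  rewrite exchange_big /=; apply: eq_bigr => k _.
  rewrite -mulmxA mxE !mulr_suml; apply: eq_bigr => l _.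
  by rewrite /flow_coef !mulrA.
rewrite mxE; apply: cvg_big => [|l _]; first exact: add_continuous.
by rewrite mxE; apply: cvgM; [exact: cvg_cst | exact: flow_cvg].
Qed.

(** The formal derivative of the series of v is the series of A v. *)
Lemma is_derive_flow (R : realType) (N : nat) (A : 'M[R]_N) (v : 'cV[R]_N) t l :
  is_derive t (1 : R) (fun s => flow A v s l 0) ((A *m flow A v t) l 0).
Proof.
rewrite mulmx_flow.
have -> : (fun s => flow A v s l 0) = (fun s => limn (pseries (flow_coef A v l) s)).
  by apply/funext => s; rewrite mxE.
have -> : (fun k => (A *m A ^+ k *m v) l 0 / k`!%:R) =
    pseries_diffs (flow_coef A v l).
  apply/funext => k; rewrite flow_coef_diffs /flow_coef mulmxA.
  by rewrite -[A *m A ^+ k]/(A * A ^+ k) -exprS exprSr.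
apply: (@pseries_snd_diffs _ _ (`|t| + 1)).
- exact: flow_cvg.
- rewrite flow_coef_diffs; exact: flow_cvg.
- rewrite !flow_coef_diffs; exact: flow_cvg.
- by rewrite [ltRHS]ger0_norm ?addr_ge0 // ltrDl.
Qed.

Lemma flow0 (R : realType) (N : nat) (A : 'M[R]_N) (v : 'cV[R]_N) :
  flow A v 0 = v.
Proof.
apply/colP => l; rewrite mxE; apply: cvg_lim => //.
(* The partial sums at t = 0 are constant except for the empty one. *)
rewrite -(cvg_shiftS _).
apply: cvg_near_cst; near=> n.
rewrite /pseries /series /= big_nat_recl //= big1 ?addr0.
  by rewrite /flow_coef expr0 mul1mx fact0 divr1 expr0 mulr1.
by move=> k _; rewrite expr0n mulr0.
Unshelve. all: by end_near.
Qed.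

(** If the unit row vector of j is not in the row space of O, some v in the
    kernel of O has a nonzero j-th component; the free motion exp(t A) v has zero
    output, like the zero trajectory, but starts from v. *)
Lemma span_of_node_observable (R : realType) (N M P : nat) (A : 'M[R]_N)
    (B : 'M[R]_(N, M)) (C : 'M[R]_(P, N)) (T : R) (j : 'I_N) :
  0 < T -> node_observable A B C T j ->
  ((delta_mx 0 j : 'rV[R]_N) <= obs_mx A C)%MS.
Proof.
move=> T0 obsj; rewrite submxE; apply/eqP/rowP => l; rewrite -rowE !mxE.
pose v := col l (cokermx (obs_mx A C)).
have Ov : obs_mx A C *m v = 0 by rewrite /v colE mulmxA mulmx_coker mul0mx.
have Cflow t : C *m flow A v t = 0.
  apply/colP => i; rewrite mulmx_flow mxE; apply: cvg_lim => //.
  apply: cvg_near_cst; near=> n; rewrite /pseries /series /= big1 // => k _.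
  by rewrite mulmx_expr_obs_ker // mxE !mul0r.
have dflow : trajectory A B T (fun=> 0) (flow A v).
  move=> i; split => [|t _].
    by apply: derivable_within_continuous => s _; have [] := is_derive_flow A v s i.
  by rewrite mulmx0 addr0; apply: is_derive_flow.
have d0 : trajectory A B T (fun=> 0) (fun=> 0).
  move=> i; split => [|t _].
    by apply: derivable_within_continuous => s _; apply: derivable_cst.
  rewrite !mulmx0 addr0; under eq_fun do rewrite mxE.
  by rewrite mxE; apply: is_derive_cst.
have := obsj _ _ _ dflow d0 _ 0 _ j; rewrite flow0 !mxE; apply.
- by move=> t _; rewrite Cflow mulmx0.
- by rewrite lexx ltW.
- by rewrite finset.inE.
Unshelve. all: by end_near.
Qed.

Lemma node_observableE (R : realType) (N M P : nat) (A : 'M[R]_N)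
    (B : 'M[R]_(N, M)) (C : 'M[R]_(P, N)) (T : R) (j : 'I_N) :
  0 < T ->
  node_observable A B C T j <-> ((delta_mx 0 j : 'rV[R]_N) <= obs_mx A C)%MS.
Proof.
move=> T0; split; first exact: span_of_node_observable.
exact: node_observable_of_span.
Qed.

(** * Correctness of the algorithm *)

Unset Implicit Arguments.

(* Every execution terminates, none gets stuck, and all output the set of
   observable nodes. *)
Theorem theorem2 (R : realType) (N M P : nat) (A : 'M[R]_N) (B : 'M[R]_(N, M))
    (C : 'M[R]_(P, N)) (T : R)
    (hC : forall i : 'I_P, exists j : 'I_N, row i C = delta_mx 0 j)
    (hT : 0 < T) :
  [/\ exists st : alg_state R N, alg_init A C st,
      forall st : alg_state R N, alg_reachable A C st ->
        ~ alg_final st -> exists st' : alg_state R N, alg_step st st',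
      forall sts : nat -> alg_state R N, alg_init A C (sts 0%N) ->
        ~ (forall k : nat, alg_step (sts k) (sts k.+1)) &
      forall st : alg_state R N, alg_reachable A C st -> alg_final st ->
        is_observable_node_set A B C T (alg_output st)].
Proof.
split.
- exact: alg_init_exists.
- move=> st /alg_reachable_invariant[wf _]; exact: alg_step_exists.
- by move=> sts _; apply: no_infinite_run.
- move=> st /alg_reachable_invariant[wf detE] final.
  apply/is_observable_node_setE => j.
  by rewrite (alg_outputP j wf final) detE; apply: iff_sym; apply: node_observableE.
Qed.
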